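(* Let $n\ge 7$ be such that $n+1=2^k$ for some integer $k$. Then there exist a monotone function $f:\{0,1\}^n\to\{0,1\}$ and a pairwise independent distribution $D$ over $\{0,1\}^n$ such that $f$ is balanced with respect to $D$ and $$\mathcal{E}_i(f,D)=0\quad\text{for all } i\in\{1,\ldots,n\}.$$
   Context: A distribution $D$ on $\{0,1\}^n$ is pairwise independent if, for $X=(X_1,\ldots,X_n)$ drawn from $D$, the variables $X_i,X_j$ are independent for all $i\neq j$. A function $f:\{0,1\}^n\to\{0,1\}$ is monotone if $f(x)\le f(y)$ whenever $x\le y$ coordinatewise. $f$ is balanced with respect to $D$ if $\mathbb{E}_{X\sim D}[f(X)]=1/2$. The effect of player $i$ in $f$ with respect to $D$ is $$\mathcal{E}_i(f,D)=\big|\mathbb{E}_{X\sim D}[f(X)\mid X_i=1]-\mathbb{E}_{X\sim D}[f(X)\mid X_i=0]\big|,$$ which is defined when both events $X_i=0$ and $X_i=1$ have positive probability; the claim includes that all these effects are defined. *)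

(* Defs.v *)
From HB Require Import structures.
From mathcomp Require Import all_boot all_order all_algebra.
From mathcomp Require Import reals.

Set Implicit Arguments.
Unset Strict Implicit.
Unset Printing Implicit Defensive.

Import Order.TTheory GRing.Theory Num.Theory.
Local Open Scope ring_scope.

Definition cube (n : nat) : finType := {ffun 'I_n -> bool}.

Record distr (R : realType) (T : finType) := Distr {
  pmf :> T -> R;
  pmf_ge0 : forall x, 0 <= pmf x;
  pmf_sum1 : \sum_(x : T) pmf x = 1 }.

Section Probability.
Variables (R : realType) (T : finType) (D : distr R T).

Definition Pr (A : pred T) : R := \sum_(x | A x) D x.

Definition Ex (g : T -> R) : R := \sum_x D x * g x.

(* Meaningful only when [0 < Pr A]; otherwise equal to 0, as x / 0 = 0. *)
Definition condEx (g : T -> R) (A : pred T) : R :=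
  (\sum_(x | A x) D x * g x) / Pr A.

Definition independent (U V : finType) (X : T -> U) (Y : T -> V) : Prop :=
  forall (u : U) (v : V),
    Pr [pred x | (X x == u) && (Y x == v)] =
    Pr [pred x | X x == u] * Pr [pred x | Y x == v].

End Probability.

Section BooleanFunctions.
Variables (R : realType) (n : nat).
Implicit Types (D : distr R (cube n)) (f : cube n -> bool).

Definition pairwise_independent D : Prop :=
  forall i j : 'I_n, i != j ->
    independent D (fun x : cube n => x i) (fun x : cube n => x j).

(* [%N]: booleans are compared as the numbers 0 and 1. *)
Definition monotone f : Prop :=
  forall x y : cube n, (forall i : 'I_n, (x i <= y i)%N) -> (f x <= f y)%N.

Definition balanced f D : Prop := Ex D (fun x => (f x)%:R) = 1 / 2%:R.

Definition effect_defined D (i : 'I_n) : Prop :=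
  forall b : bool, 0 < Pr D [pred x : cube n | x i == b].

Definition effect f D (i : 'I_n) : R :=
  `| condEx D (fun x => (f x)%:R) [pred x : cube n | x i == true]
   - condEx D (fun x => (f x)%:R) [pred x : cube n | x i == false] |.

End BooleanFunctions.

(* Main.v *)
Require Import Defs.
From HB Require Import structures.
From mathcomp Require Import all_boot all_order all_algebra.
From mathcomp Require Import reals.
From mathcomp Require Import ring.

Set Implicit Arguments.
Unset Strict Implicit.
Unset Printing Implicit Defensive.

Import Order.TTheory GRing.Theory Num.Theory.
Local Open Scope ring_scope.

(** Identify the [n = 2 ^ k - 1] players with the nonzero points [v] of the
    vector space [bool ^ k] over the two-element field [bool].  Draw a uniformly
    random affine function [l = (a, s)], [l(v) = <v, a> + s], and let player [v]
    receive the bit [l(v)]; this is a random word of the punctured Hadamard code.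
    Let [f x] hold when [x] dominates the values of some affine function with
    constant term [s = 1]; this is monotone by construction.

    The point is that [f] computes the constant term: [f(l) = s] for every [l]
    ([dominates_aff_word]).  If [s = 1] this is immediate.  If [s = 0] and [l]
    dominated some [(b, 1)], then at a nonzero [v] orthogonal to both [a] and
    [b] the function [l] takes the value 0 and [(b, 1)] the value 1; such a [v]
    exists as soon as [k >= 3], that is, [n >= 7].

    Since [s = l(0)], all the probabilistic claims concern the values of a
    random affine function at two distinct points, which are independent
    uniform bits ([Pr_aff_pair]): at two nonzero points this is pairwise
    independence; at [0] and a nonzero point it says that [f] is independent of
    every single player, so that all the effects vanish. *)

(** * Uniform laws and their images *)

Lemma image_law_ge0 (R : realType) (W T : finType) (phi : W -> T) (x : T) :
  0 <= \sum_(w | phi w == x) (#|W|%:R^-1 : R).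
Proof. by apply: sumr_ge0 => w _; rewrite invr_ge0 ler0n. Qed.

Lemma image_law_sum1 (R : realType) (W T : finType) (w0 : W) (phi : W -> T) :
  \sum_x \sum_(w | phi w == x) (#|W|%:R^-1 : R) = 1.
Proof.
have <- : \sum_(w : W) (#|W|%:R^-1 : R) = \sum_x \sum_(w | phi w == x) #|W|%:R^-1.
  by rewrite (partition_big phi xpredT).
rewrite sumr_const -[_ *+ _]mulr_natr mulVf // pnatr_eq0 -lt0n.
by apply/card_gt0P; exists w0.
Qed.

(** The element [w0] witnesses that [W] is nonempty, hence has a uniform law. *)
Definition image_law (R : realType) (W T : finType) (w0 : W) (phi : W -> T) :
    distr R T :=
  Distr (image_law_ge0 R phi) (image_law_sum1 R w0 phi).

Lemma image_law_sum (R : realType) (W T : finType) (w0 : W) (phi : W -> T)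
    (A : pred T) (g : T -> R) :
  \sum_(x | A x) image_law R w0 phi x * g x =
  \sum_(w | A (phi w)) #|W|%:R^-1 * g (phi w).
Proof.
rewrite [RHS](partition_big phi A) //=; apply: eq_bigr => x Ax.
rewrite mulr_suml; apply: eq_big => [w | w /eqP -> //].
by case: eqP => [->|_]; rewrite ?Ax ?andbF.
Qed.

Lemma Pr_image_law (R : realType) (W T : finType) (w0 : W) (phi : W -> T)
    (A : pred T) :
  Pr (image_law R w0 phi) A = #|[pred w | A (phi w)]|%:R / #|W|%:R.
Proof.
have -> : Pr (image_law R w0 phi) A =
    \sum_(x | A x) image_law R w0 phi x * 1.
  by apply: eq_bigr => x _; rewrite mulr1.
rewrite image_law_sum mulr1 sumr_const -[LHS]mulr_natl; congr (_%:R * _).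
Qed.

(** A map that flips the bit [Z] and preserves the event [P] matches the two
    halves [Z = 0] and [Z = 1] of [P]. *)
Lemma card_flip (W : finType) (P : pred W) (Z : W -> bool) (sigma : W -> W) :
    injective sigma -> (forall w, P (sigma w) = P w) ->
    (forall w, Z (sigma w) = ~~ Z w) ->
  forall u, (2 * #|[pred w | P w && (Z w == u)]| = #|P|)%N.
Proof.
move=> sigma_inj Psigma Zsigma u.
rewrite -!sum1_card [RHS](bigID (fun w => Z w == u)) /= mul2n -addnn.
congr (_ + _)%N; rewrite [RHS](reindex_inj sigma_inj).
apply: eq_bigl => w; rewrite !inE -!topredE /= Psigma Zsigma.
by case: (Z w) u => [] [].
Qed.

(** * Affine functions over the two-element field *)

(** The pair [(a, s)] stands for the affine function [v |-> <v, a> + s]. *)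
Definition aff (k : nat) : finType := ('rV[bool]_k * bool)%type.

Definition aff_eval (k : nat) (l : aff k) (v : 'rV[bool]_k) : bool :=
  (v *m l.1^T) 0 0 + l.2.

Definition aff_add (k : nat) (t l : aff k) : aff k := (t.1 + l.1, t.2 + l.2).

Lemma aff_add_inj (k : nat) (t : aff k) : injective (aff_add t).
Proof.
by move=> [a s] [b u] [/addrI -> /addrI ->].
Qed.

Lemma aff_evalD (k : nat) (t l : aff k) (v : 'rV[bool]_k) :
  aff_eval (aff_add t l) v = aff_eval t v + aff_eval l v.
Proof. by rewrite /aff_eval /= linearD mulmxDr mxE addrACA. Qed.

Lemma aff_eval0 (k : nat) (l : aff k) : aff_eval l 0 = l.2.
Proof. by rewrite /aff_eval mul0mx mxE add0r. Qed.

(** Two points that differ in coordinate [j] are separated by the function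
    [x |-> x_j + w_j]. *)
Lemma aff_separate (k : nat) (v w : 'rV[bool]_k) : v != w ->
  exists t : aff k, aff_eval t v = true /\ aff_eval t w = false.
Proof.
move=> neq_vw; have [j neq_j] : exists j, v 0 j != w 0 j.
  by apply/existsP; rewrite -negb_forall; apply: contra neq_vw => /forallP eq_vw;
     apply/eqP/rowP => j; apply/eqP.
exists (delta_mx 0 j, w 0 j).
rewrite /aff_eval /= trmx_delta -!colE !mxE.
by case: (v 0 j) (w 0 j) neq_j => [] [].
Qed.

(** Translating by a function that is 1 at [v] and 0 at [w] flips the value at
    [v] only; by symmetry the value at [w] can be flipped alone as well. *)
Lemma card_aff_value (k : nat) (v w : 'rV[bool]_k) (u : bool) : v != w ->
  (2 * #|[pred l : aff k | aff_eval l v == u]| = #|aff k|)%N.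
Proof.
move=> /aff_separate [t [tv _]].
apply: (card_flip (P := predT) (@aff_add_inj k t)) => // l.
by rewrite aff_evalD tv.
Qed.

Lemma card_aff_pair (k : nat) (v w : 'rV[bool]_k) (u b : bool) : v != w ->
  (4 * #|[pred l : aff k | (aff_eval l v == u) && (aff_eval l w == b)]|
   = #|aff k|)%N.
Proof.
move=> neq_vw; rewrite -(card_aff_value u neq_vw) -[4%N]/(2 * 2)%N -mulnA.
congr (2 * _)%N; move: neq_vw; rewrite eq_sym => /aff_separate [t [tw tv]].
by apply: (card_flip (P := [pred l | aff_eval l v == u]) (@aff_add_inj k t)) => l;
   rewrite /= aff_evalD ?tw ?tv.
Qed.

Lemma Pr_aff_value (R : realType) (k : nat) (v w : 'rV[bool]_k) (u : bool) :
  v != w -> #|[pred l : aff k | aff_eval l v == u]|%:R / #|aff k|%:R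
            = 2%:R^-1 :> R.
Proof.
move=> neq_vw; have aff_gt0 : #|aff k|%:R != 0 :> R.
  by rewrite pnatr_eq0 -lt0n; apply/card_gt0P; exists (0, false).
by have := congr1 (fun m => m%:R : R) (card_aff_value u neq_vw);
   rewrite natrM => E; field: E.
Qed.

Lemma Pr_aff_pair (R : realType) (k : nat) (v w : 'rV[bool]_k) (u b : bool) :
  v != w ->
  #|[pred l : aff k | (aff_eval l v == u) && (aff_eval l w == b)]|%:R
    / #|aff k|%:R = 4%:R^-1 :> R.
Proof.
move=> neq_vw; have aff_gt0 : #|aff k|%:R != 0 :> R.
  by rewrite pnatr_eq0 -lt0n; apply/card_gt0P; exists (0, false).
by have := congr1 (fun m => m%:R : R) (card_aff_pair u b neq_vw);
   rewrite natrM => E; field: E.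
Qed.

(** The two orthogonality conditions are linear equations, and there are fewer
    of them than unknowns. *)
Lemma exists_orthogonal (k : nat) (a b : 'rV[bool]_k) : (2 < k)%N ->
  exists v : 'rV[bool]_k, [/\ v != 0, v *m a^T = 0 & v *m b^T = 0].
Proof.
move=> k_gt2; pose M := row_mx a^T b^T.
have : kermx M != 0.
  rewrite kermx_eq0 /row_free neq_ltn; apply/orP; left.
  exact: leq_ltn_trans (rank_leq_col M) k_gt2.
case/rowV0Pn => v /sub_kermxP; rewrite mul_mx_row -row_mx0 => /eq_row_mx [va vb] v0.
by exists v.
Qed.

(** * The code and the monotone function *)

Definition aff_word (n k : nat) (pt : 'I_n -> 'rV[bool]_k) (l : aff k) : cube n :=
  [ffun i => aff_eval l (pt i)].

Definition dominates (n k : nat) (pt : 'I_n -> 'rV[bool]_k) (x : cube n) : bool :=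
  [exists a : 'rV[bool]_k, [forall i, aff_eval (a, true) (pt i) ==> x i]].

Lemma dominates_monotone (n k : nat) (pt : 'I_n -> 'rV[bool]_k) :
  monotone (dominates pt).
Proof.
move=> x y le_xy; case: (boolP (dominates pt x)) => // /existsP [a /forallP ax].
suff -> : dominates pt y by [].
apply/existsP; exists a; apply/forallP => i; apply/implyP => /(implyP (ax i)) xi.
by move: (le_xy i); rewrite xi; case: (y i).
Qed.

Lemma dominates_aff_word (n k : nat) (pt : 'I_n -> 'rV[bool]_k) (l : aff k) :
    (2 < k)%N -> (forall v, v != 0 -> exists i, pt i = v) ->
  dominates pt (aff_word pt l) = l.2.
Proof.
case: l => a [] k_gt2 pt_onto /=.
  by apply/existsP; exists a; apply/forallP => i; apply/implyP; rewrite ffunE.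
apply/negbTE/negP => /existsP [b /forallP dom_b].
have [v [v0 va vb]] := exists_orthogonal a b k_gt2.
have [i pt_i] := pt_onto v v0.
by move: (dom_b i); rewrite ffunE pt_i /aff_eval /= va vb mxE.
Qed.

(** Counting: exactly [2 ^ k - 1] points of [bool ^ k] are nonzero. *)
Lemma nonzero_points (n k : nat) : (n + 1 = 2 ^ k)%N ->
  exists pt : 'I_n -> 'rV[bool]_k,
    [/\ injective pt, forall i, pt i != 0 & forall v, v != 0 -> exists i, pt i = v].
Proof.
move=> n_pow; pose A := predC1 (0 : 'rV[bool]_k).
have cardA : n = #|A|.
  by rewrite (cardC1 (0 : 'rV[bool]_k)) card_mx card_bool mul1n -n_pow addn1.
exists (fun i => enum_val (cast_ord cardA i)); split.
- by move=> i j /enum_val_inj /cast_ord_inj.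
- by move=> i; have := enum_valP (cast_ord cardA i).
- move=> v v0; exists (cast_ord (esym cardA) (enum_rank_in (v0 : v \in A) v)).
  by rewrite cast_ordKV enum_rankK_in.
Qed.

Theorem mainTheorem4 (R : realType) (n : nat) (n_ge7 : (7 <= n)%N)
    (n_pow2 : exists k : nat, (n + 1 = 2 ^ k)%N) :
  exists (f : cube n -> bool) (D : distr R (cube n)),
    [/\ monotone f,
        pairwise_independent D,
        balanced f D &
        forall i : 'I_n, effect_defined D i /\ effect f D i = 0].
Proof.
case: n_pow2 => k n_pow.
have k_gt2 : (2 < k)%N.
  by rewrite -(ltn_exp2l 2 k (m := 2)) // -n_pow addn1 ltnS (leq_trans _ n_ge7).
have [pt [pt_inj pt_neq0 pt_onto]] := nonzero_points n_pow.
pose f := dominates pt; pose l0 : aff k := (0, false).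
pose D := image_law R l0 (aff_word pt).
(* The constant term of [l] is its value at the extra point [0], where no
   player sits. *)
have fE l : f (aff_word pt l) = aff_eval l 0.
  by rewrite /f dominates_aff_word // aff_eval0.
have Pr_bit (i : 'I_n) b : Pr D [pred x : cube n | x i == b] = 2%:R^-1.
  rewrite Pr_image_law -(Pr_aff_value R b (pt_neq0 i)).
  by congr (_%:R / _); apply: eq_card => l; rewrite !inE ffunE.
have mean_f (A : pred (cube n)) : \sum_(x | A x) D x * (f x)%:R =
    #|[pred l | A (aff_word pt l) && (aff_eval l 0 == true)]|%:R / #|aff k|%:R.
  rewrite image_law_sum -mulr_sumr mulrC; congr (_ / _).
  rewrite -sum1_card natr_sum [RHS]big_mkcondr /=.
  by apply: eq_bigr => l _; rewrite fE; case: (aff_eval l 0).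
exists f, D; split.
- exact: dominates_monotone.
- move=> i j neq_ij u b; rewrite !Pr_bit.
  have neq_pt : pt i != pt j by apply: contra neq_ij => /eqP/pt_inj ->.
  rewrite Pr_image_law -invfM -natrM -(Pr_aff_pair R u b neq_pt).
  by congr (_%:R / _); apply: eq_card => l; rewrite !inE !ffunE.
- rewrite /balanced /Ex (mean_f predT) div1r.
  have := pt_neq0 (Ordinal (leq_trans (isT : (0 < 7)%N) n_ge7)).
  by rewrite eq_sym => /(Pr_aff_value R true).
- move=> i; split=> [b|]; first by rewrite Pr_bit invr_gt0 ltr0n.
  have mean_bit b :
      condEx D (fun x => (f x)%:R) [pred x : cube n | x i == b] = 4%:R^-1 / 2%:R^-1.
    rewrite /condEx Pr_bit mean_f -(Pr_aff_pair R b true (pt_neq0 i)).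
    by congr (_%:R / _ / _); apply: eq_card => l; rewrite !inE ffunE.
  by rewrite /effect !mean_bit subrr normr0.
Qed.
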